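(* Let $n,m$ be positive integers and let $G$ be a group of type $(n,m)$. Then $G$ is supersolvable.
   Context: A group $G$ is of type $(n,m)$, where $n,m$ are positive integers, if there is an integer $t$ with $1<t<m$ such that $G=\langle s,r \mid s^n=r^m=1,\ sr=r^t s\rangle$, and each element $x\in G$ can be written uniquely as $x=s^i r^j$ with integers $0\le i<n$, $0\le j<m$ (so that $|G|=nm$). A group $G$ is supersolvable if there exist normal subgroups $G_0,\dots,G_n$ of $G$ with $\{1\}=G_0\subseteq G_1\subseteq\cdots\subseteq G_n=G$ such that each factor $G_i/G_{i-1}$ is cyclic for $1\le i\le n$ (the length $n$ of this series is unrelated to the $n$ in ''type $(n,m)$''). *)

(* Defs.v *)
From mathcomp Require Import all_boot all_fingroup all_solvable.

Set Implicit Arguments.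
Unset Strict Implicit.
Unset Printing Implicit Defensive.

Local Open Scope group_scope.

(* The presentation condition alone determines G only up to isomorphism, so the
   pair (s, r) is also required to generate G and satisfy the relations.  Since
   any group with this presentation is finite (its elements are the words
   r^j s^i with i < n and j < m), "\isog Grp" denotes the presented group
   itself, and by finiteness every generating pair of G satisfying the
   relations is a presenting pair. *)
Definition group_of_type (n m : nat) (gT : finGroupType) (G : {group gT}) :
    Prop :=
  exists t : nat, exists s r : gT,
    [/\ 1 < t < m,
        G \isog Grp (a : b : a ^+ n = b ^+ m = 1, a * b = b ^+ t * a),
        <[s]> <*> <[r]> = G,
        [/\ s ^+ n = 1, r ^+ m = 1 & s * r = r ^+ t * s]
      & forall x : gT, x \in G ->
          exists! ij : 'I_n * 'I_m, x = s ^+ ij.1 * r ^+ ij.2].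

Definition supersolvable (gT : finGroupType) (G : {group gT}) : Prop :=
  exists (l : nat) (H : nat -> {group gT}),
    [/\ H 0 = 1%G, H l = G,
        forall i : nat, i <= l -> H i <| G
      & forall i : nat, i < l -> H i \subset H i.+1 /\ cyclic (H i.+1 / H i)].

(* Main.v *)
(* The relation s r = r^t s says that s normalises <[r]>, and G / <[r]> is then
   generated by the image of s: the series 1 <= <[r]> <= G has cyclic factors. *)
Require Import Defs.
From mathcomp Require Import all_boot all_fingroup all_solvable.

(** [G] is cyclic by cyclic: [conj_in_cycle_norm] makes [<[r]>] normal in the join of [<[s]>] and
    [<[r]>], which is [G]. *)

Lemma conj_in_cycle_norm (gT : finGroupType) (s r : gT) (t : nat) :
  (s * r = r ^+ t * s)%g -> s \in 'N(<[r]>)%g.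
Proof.
(* Since [x ^ y] is [y^-1 * x * y], the relation computes the conjugate of [r] by [s^-1], namely
   [r ^+ t]; hence the passage to [s^-1]. *)
move=> sr; rewrite -groupV inE -genJ gen_subG /= conjg_set1 sub1set.
by rewrite conjgE invgK mulgA sr mulgK mem_cycle.
Qed.

Theorem theorem15 (n m : nat) (n_gt0 : 0 < n) (m_gt0 : 0 < m)
    (gT : finGroupType) (G : {group gT}) :
  group_of_type n m G -> supersolvable G.
Proof.
move=> [t [s [r [_ _ defG [_ _ sr] _]]]].
have sN : (<[s]> \subset 'N(<[r]>))%g by rewrite cycle_subG (conj_in_cycle_norm _ _ _ _ sr).
have nrG : (<[r]> <| G)%g by rewrite -defG normalYr.
exists 2, (fun i => if i is i'.+1 then if i' is 0 then <[r]>%G else G else 1%G).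
split=> // [[|[|i]] _|[|[|i]]] //=; first exact: normal1.
- by rewrite sub1G quotient_cyclic ?cycle_cyclic.
(* The join collapses modulo [<[r]>], so [G / <[r]>] is the image of the cyclic group [<[s]>]. *)
- rewrite (normal_sub nrG) -[X in (X / _)%g]defG joingC quotientYidl //.
  by split=> //; rewrite quotient_cyclic ?cycle_cyclic.
Qed.
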